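(* Let $X_1,X_2,\dots$ be independent real random variables with $E[X_j]=0$, $0<\sigma_j^2:=E[X_j^2]$ and $\xi_j:=E|X_j|^3<\infty$ for all $j\ge1$. Let $p\in(0,1)$ and let $N=N_p$ be independent of the sequence $(X_j)_{j\ge1}$ with the geometric distribution $P(N=n)=p(1-p)^{n-1}$, $n=1,2,\dots$. For $n\ge1$ put $\hat\sigma_n^2:=\frac1n\sum_{j=1}^n\sigma_j^2$ (with $\hat\sigma_n>0$) and $\hat\xi_n:=\frac1n\sum_{j=1}^n\xi_j$. Assume that the limit $\hat\sigma^2:=\lim_{n\to\infty}\frac1n\sum_{j=1}^n\sigma_j^2$ exists and satisfies $0<\hat\sigma^2<\infty$ (with $\hat\sigma>0$). Put $W:=\sqrt p\,\sum_{j=1}^NX_j$. Then $$d_{\mathcal K}\Bigl(\mathcal L(W),\mathrm{Laplace}\bigl(0,\tfrac{\hat\sigma}{\sqrt2}\bigr)\Bigr)\le 12p+p\sum_{n=1}^\infty(1-p)^{n-1}\min\Bigl(\Bigl|1-\frac{\hat\sigma^2}{\hat\sigma_n^2}\Bigr|,\Bigl|1-\frac{\hat\sigma_n^2}{\hat\sigma^2}\Bigr|\Bigr)+C_{\mathcal K}\,E\Bigl[\frac{1}{\sqrt N}\frac{\hat\xi_N}{\hat\sigma_N^3}\Bigr].$$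
   Context: $\mathcal L(Y)$ denotes the distribution of a random variable $Y$. $d_{\mathcal K}(\mu,\nu):=\sup_{z\in\mathbb R}|\mu((-\infty,z])-\nu((-\infty,z])|$ is the Kolmogorov distance of probability measures on $\mathbb R$. $\mathrm{Laplace}(a,b)$, for $a\in\mathbb R$, $b>0$, is the distribution with density $x\mapsto\frac{1}{2b}e^{-|x-a|/b}$. $C_{\mathcal K}$ is the (finite, absolute) Berry-Esseen constant, i.e. a constant such that for all $n\ge1$ and all independent random variables $Y_1,\dots,Y_n$ with $E[Y_j]=0$, $E[Y_j^2]>0$, $E|Y_j|^3<\infty$, writing $B_n^2=\sum_{j=1}^nE[Y_j^2]$, one has $d_{\mathcal K}\bigl(\mathcal L(B_n^{-1}\sum_{j=1}^nY_j),N(0,1)\bigr)\le C_{\mathcal K}B_n^{-3}\sum_{j=1}^nE|Y_j|^3$. The expectation on the right-hand side is of a nonnegative random variable and may be $+\infty$. (Here $E[N]=1/p$, so $W=E[N]^{-1/2}\sum_{j=1}^NX_j$.) *)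

(* Defs.v *)
From HB Require Import structures.
From mathcomp Require Import all_boot all_order all_algebra.
From mathcomp Require Import all_classical all_reals all_analysis.
From mathcomp Require Import measurable_realfun.

Set Implicit Arguments.
Unset Strict Implicit.
Unset Printing Implicit Defensive.

Import Order.TTheory GRing.Theory Num.Theory.
Import numFieldNormedType.Exports.

Local Open Scope classical_set_scope.
Local Open Scope ring_scope.

Section independence.
Context d (T : measurableType d) (R : realType) (P : probability T R).

Definition mutually_independent (I : eqType) (X : I -> {RV P >-> R}) : Prop :=
  forall (s : seq I) (A : I -> set R), uniq s ->
    (forall i, measurable (A i)) ->
    P (\bigcap_(i in [set` s]) X i @^-1` A i) =
    (\prod_(i <- s) P (X i @^-1` A i))%E.

Definition sigma_algebra_of (I : Type) (X : I -> {RV P >-> R}) :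
    set (set T) :=
  <<s \bigcup_i preimage_set_system setT (X i) measurable >>.

Definition independent_of_family d' (T' : measurableType d')
    (N : {RV P >-> T'}) (I : Type) (X : I -> {RV P >-> R}) : Prop :=
  forall (B : set T') (E : set T), measurable B -> sigma_algebra_of X E ->
    P (N @^-1` B `&` E) = (P (N @^-1` B) * P E)%E.

End independence.

(* Takes set functions because the probability instance of [laplace_prob]
   below depends on a proof that the scale is positive. *)
Definition kolmogorov_dist (R : realType) (mu nu : set R -> \bar R) : \bar R :=
  ereal_sup
    [set `| mu (`]-oo, z]%classic) - nu (`]-oo, z]%classic) |%E | z in [set: R]].

Definition laplace_pdf (R : realType) (a b x : R) : R :=
  (2 * b)^-1 * expR (- `|x - a| / b).

Definition laplace_prob (R : realType) (a b : R) : set R -> \bar R :=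
  fun V => (\int[lebesgue_measure]_(x in V) (laplace_pdf a b x)%:E)%E.

Section laplace_probability.
Context (R : realType) (a b : R).
Hypothesis b_gt0 : 0 < b.
Notation mu := (@lebesgue_measure R).

Lemma laplace_pdf_ge0 x : 0 <= laplace_pdf a b x.
Proof. by rewrite mulr_ge0 ?expR_ge0// invr_ge0 mulr_ge0// ltW. Qed.

Lemma continuous_laplace_pdf (c : R) : continuous (laplace_pdf c b).
Proof.
move=> x; apply: cvgM; first exact: cvg_cst.
apply: (cvg_comp _ expR); last exact: continuous_expR.
apply: cvgM; last exact: cvg_cst.
apply: (@cvgN _ R^o); apply: (@cvg_norm _ R^o).
by apply: (@cvgB _ R^o) => //; exact: cvg_cst.
Qed.

Lemma integral_laplace_pdf : (\int[mu]_x (laplace_pdf a b x)%:E = 1)%E.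
Proof.
have F'E : (fun x : R => x - a)^`()%classic = cst 1.
  apply/funext => x; rewrite derive1E deriveB// derive_id derive_cst.
  by rewrite subr0.
transitivity (\int[mu]_x (((laplace_pdf 0 b \o (fun x => x - a)) *
    (fun x : R => x - a)^`()%classic) x)%:E)%E.
  apply: eq_integral => x _; rewrite F'E !fctE /laplace_pdf subr0.
  by rewrite mulr1.
rewrite -increasing_ge0_integration_by_substitutionT//; first last.
- by move=> x; rewrite mulr_ge0 ?expR_ge0// invr_ge0 mulr_ge0// ltW.
- exact: continuous_laplace_pdf.
- exact: cvg_addrr.
- exact: cvg_addrr_Ny.
- by rewrite F'E; exact: is_cvg_cst.
- by rewrite F'E; exact: is_cvg_cst.
- by rewrite F'E => ?; exact: cvg_cst.
- by move=> x y xy; rewrite ltrD2r.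
rewrite ge0_symfun_integralT; first last.
- by move=> x; rewrite /= /laplace_pdf !subr0 normrN.
- exact: continuous_laplace_pdf.
- by move=> x; rewrite mulr_ge0 ?expR_ge0// invr_ge0 mulr_ge0// ltW.
have binv0 : 0 < b^-1 by rewrite invr_gt0.
rewrite -(integral_exponential_pdf binv0).
rewrite /exponential_pdf.
under [RHS]eq_integral => x _.
  rewrite -[(_ \_ _ x)%:E]/((EFin \o (_ \_ _)) x) -restrict_EFin.
  over.
rewrite -integral_mkcond -set_itvcy -ge0_integralZl//=.
- apply: eq_integral => x; rewrite inE/= in_itv/= andbT => x0.
  rewrite -EFinM /laplace_pdf subr0 ger0_norm// invfM mulrA mulrA.
  by rewrite divff ?pnatr_eq0// mul1r; congr (_ * expR _)%:E;
    rewrite mulNr mulrC mulNr.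
- apply/measurable_EFinP/measurable_funTS.
  by apply: continuous_measurable_fun; exact: continuous_laplace_pdf.
- by move=> x _; rewrite lee_fin mulr_ge0 ?expR_ge0// invr_ge0 mulr_ge0// ltW.
Qed.

Local Notation laplace := (laplace_prob a b).

Let laplace0 : laplace set0 = 0%E.
Proof. by rewrite /laplace_prob integral_set0. Qed.

Let laplace_ge0 A : (0 <= laplace A)%E.
Proof. by apply: integral_ge0 => x _; rewrite lee_fin laplace_pdf_ge0. Qed.

Let laplace_sigma_additive : semi_sigma_additive laplace.
Proof.
move=> /= F mF tF mUF; rewrite /laplace_prob; apply: cvg_toP.
  apply: ereal_nondecreasing_is_cvgn => m n mn.
  apply: lee_sum_nneg_natr => // k _ _; apply: integral_ge0 => /= x Fkx.
  by rewrite lee_fin laplace_pdf_ge0.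
rewrite ge0_integral_bigcup//=.
- apply/measurable_funTS/measurableT_comp => //.
  by apply: continuous_measurable_fun; exact: continuous_laplace_pdf.
- by move=> x _; rewrite lee_fin laplace_pdf_ge0.
Qed.

HB.instance Definition _ := isMeasure.Build _ _ _
  laplace laplace0 laplace_ge0 laplace_sigma_additive.

Let laplace_setT : laplace [set: R] = 1%E.
Proof. by rewrite /laplace_prob integral_laplace_pdf. Qed.

HB.instance Definition _ :=
  @Measure_isProbability.Build _ _ R laplace laplace_setT.

End laplace_probability.

Section random_sum.
Context d (T : measurableType d) (R : realType) (P : probability T R).
Variables (X : nat -> {RV P >-> R}) (N : {RV P >-> nat}).

(* Sequences are indexed from 0: X j is the (j+1)-st variable, so the sum over
   j < N w consists of the first N w variables. *)
Definition random_sum (w : T) : R := \sum_(j < N w) X j w.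

Lemma measurable_random_sum : measurable_fun setT random_sum.
Proof.
move=> _ A mA; rewrite setTI.
have -> : random_sum @^-1` A = \bigcup_n (N @^-1` [set n] `&`
    (fun w => \sum_(j < n) X j w) @^-1` A).
  apply/seteqP; split => w /=.
    by move=> Aw; exists (N w).
  by move=> [n _ /= [<-]].
apply: bigcupT_measurable => n; apply: measurableI.
  by rewrite -[X in measurable X]setTI; exact: measurable_funP.
rewrite -[X in measurable X]setTI.
have mf : measurable_fun setT (fun w => \sum_(j < n) X j w).
  by apply: measurable_sum => j; exact: measurable_funP.
exact: mf.
Qed.

HB.instance Definition _ :=
  @isMeasurableFun.Build _ _ _ _ random_sum measurable_random_sum.

End random_sum.

Section moments.
Context d (T : measurableType d) (R : realType) (P : probability T R).

(* [fine] loses nothing for variables with a finite third absolute moment. *)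
Definition second_moment (X : {RV P >-> R}) : R :=
  fine ('E_P[fun w => (X w ^+ 2)%R])%E.

Definition abs_third_moment (X : {RV P >-> R}) : R :=
  fine ('E_P[fun w => (`|X w| ^+ 3)%R])%E.

(* The square of \hat\sigma_n. *)
Definition mean_second_moment (X : nat -> {RV P >-> R}) (n : nat) : R :=
  n%:R^-1 * \sum_(j < n) second_moment (X j).

Definition mean_abs_third_moment (X : nat -> {RV P >-> R}) (n : nat) : R :=
  n%:R^-1 * \sum_(j < n) abs_third_moment (X j).

End moments.

(* C is the same for all probability spaces and all n; it is not assumed to be
   optimal. *)
Definition berry_esseen_constant (R : realType) (C : R) : Prop :=
  forall (d : measure_display) (T : measurableType d) (P : probability T R)
    (n : nat) (Y : 'I_n -> {RV P >-> R}),
    (0 < n)%N ->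
    mutually_independent Y ->
    (forall j, 'E_P[Y j] = 0)%E ->
    (forall j, 0 < 'E_P[fun w => (Y j w ^+ 2)%R])%E ->
    (forall j, 'E_P[fun w => (`|Y j w| ^+ 3)%R] < +oo)%E ->
    let B := Num.sqrt (\sum_(j < n) second_moment (Y j)) in
    let S : {mfun T >-> R} := B^-1 *: (\sum_(j < n) Y j : {mfun T >-> R}) in
    (kolmogorov_dist (distribution P S) (normal_prob 0 1) <=
      (C * (B ^- 3 * \sum_(j < n) abs_third_moment (Y j)))%:E)%E.

(* Main.v *)
Require Import Defs.
From HB Require Import structures.
From mathcomp Require Import all_boot all_order all_algebra.
From mathcomp Require Import all_classical all_reals all_analysis.
From mathcomp Require Import measurable_realfun ring lra.
Set Implicit Arguments.
Unset Strict Implicit.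
Unset Printing Implicit Defensive.

Import Order.TTheory GRing.Theory Num.Theory.
Import numFieldNormedType.Exports.

Local Open Scope classical_set_scope.
Local Open Scope ring_scope.

(** Conditionally on [N = n], the variable [W] is [sqrt p] times the sum of the
    first [n] variables, so that its law is close to a centred normal law, and
    [W] itself is close to a mixture of centred normal laws over the geometric
    distribution.  The Laplace law is the mixture of centred normal laws whose
    variance is [sigmahat ^+ 2] times a standard exponential variable, and [p N]
    is nearly exponential.  Three errors add up, for each argument [z]:

    - replacing the sum of [n] variables by a normal variable with the same
      variance costs the Berry-Esseen bound; averaged over the geometric weights
      it is the expectation in the bound ([berry_esseen_mean],
      [expectation_split_ge]);

    - replacing the mean variance of the first [n] variables by its limit costs
      at most the minimum in the bound, because the normal distribution function
      [Phi] is concave on the nonnegative half-line ([Phi_concave],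
      [Phi_scale]);

    - replacing the geometric mixture of normal laws by the exponential one
      costs a multiple of [p] ([geometric_mixture]).

    The third step needs no integral over the mixing variable.  For [z > 0], the
    function [t |-> Phi (z / t)], integrated against the law of the square root
    of an exponential variable, has an explicit primitive [mix_prim], whose
    limits at [0] and at infinity produce the Laplace distribution function.
    Splitting the half-line at the points [geometric_time p n] gives intervals
    of mass [p (1 - p) ^ (n - 1)].  Since [Phi (z / t)] decreases in [t], the
    increments of [mix_prim] lie between the left and the right Riemann sums
    with geometric weights, which differ by at most [p].  Finally the grid
    points differ from [sqrt (p n)] by a factor close to [1], and concavity of
    [Phi] is used again ([Phi_tau]).

    All comparisons are made for finite sums over [n <= M], with [M] so large
    that the remaining geometric tail and the distance of [mix_prim] to its
    limit are at most a multiple of [p]; the constant [12] leaves ample room. *)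

(** * Distribution functions of laws with a continuous density *)

Section density.
Context (R : realType).
Local Notation mu := (@lebesgue_measure R).

Definition cdf_of (Q : set R -> \bar R) (x : R) : R := fine (Q `]-oo, x]%classic).

Lemma is_derive_cdf_of (f : R -> R) (x : R) :
  mu.-integrable setT (EFin \o f) -> {for x, continuous f} ->
  is_derive x 1 (cdf_of (fun V => \int[mu]_(t in V) (f t)%:E)%E) (f x).
Proof.
move=> intf cf.
have [] := @continuous_FTC1 R f -oo%O x (x + 1) _ _ _ cf.
- by rewrite ltrDl.
- exact: integrableS intf.
- exact: ltNyr.
- by move=> df <-; rewrite derive1E; exact: derivableP.
Qed.

Lemma cvg_cdf_ofy (Q : probability R R) :
  cdf_of Q x @[x --> +oo] --> (1 : R).
Proof.
pose Y : R -> R := idfun.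
have mY : measurable_fun setT Y by exact: measurable_id.
pose mYM := isMeasurableFun.Build _ _ _ _ Y mY.
pose Y' : {RV Q >-> R} := HB.pack Y mYM.
exact: (fine_cvg (cvg_cdfy1 Y')).
Qed.

Lemma cvg_cdf_ofNy (Q : probability R R) :
  cdf_of Q x @[x --> -oo] --> (0 : R).
Proof.
pose Y : R -> R := idfun.
have mY : measurable_fun setT Y by exact: measurable_id.
pose mYM := isMeasurableFun.Build _ _ _ _ Y mY.
pose Y' : {RV Q >-> R} := HB.pack Y mYM.
exact: (fine_cvg (cvg_cdfNy0 Y')).
Qed.

Lemma is_derive_continuous (f : R -> R) (x df : R) :
  is_derive x 1 f df -> {for x, continuous f}.
Proof.
by move=> [dfx _]; apply: differentiable_continuous; apply/derivable1_diffP.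
Qed.

Lemma MVT_is_derive (f df : R -> R) (a b : R) : a <= b ->
  (forall x, a <= x <= b -> is_derive x 1 f (df x)) ->
  exists2 c, a <= c <= b & f b - f a = df c * (b - a).
Proof.
move=> ab fdf; have [] := @MVT_segment R f df a b ab.
- by move=> x; rewrite in_itv/= => /andP[ax xb]; apply: fdf; rewrite !ltW.
- apply/continuous_in_subspaceT => x; rewrite inE/= in_itv/= => xab.
  exact: is_derive_continuous (fdf _ xab).
- by move=> c; rewrite in_itv/=; exists c.
Qed.

(** Determines a distribution function from its density and its limit at
    infinity: [f] is the difference of the function and a primitive of the
    density. *)
Lemma eq_cvg_derive0 (f : R -> R) (a l : R) :
  (forall x, a < x -> is_derive x 1 f 0) -> {for a, continuous f} ->
  f x @[x --> +oo] --> l -> f a = l.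
Proof.
move=> df cf fl.
suff fa : forall y, a < y -> f y = f a.
  have : f x @[x --> +oo] --> f a.
    apply: cvg_near_cst; near=> y; apply: fa.
    by near: y; apply: nbhs_pinfty_gt; rewrite num_real.
  by move=> /(cvg_unique (@Rhausdorff R)) /(_ fl).
move=> y ay.
have [] := @MVT R f (fun=> 0) a y ay.
- by move=> x; rewrite in_itv/= => /andP[ax _]; exact: df.
- apply/continuous_in_subspaceT => x; rewrite inE/= in_itv/= => /andP[].
  rewrite le_eqVlt => /predU1P[<- //|ax _].
  exact: is_derive_continuous (df _ ax).
- by move=> c _ /eqP; rewrite mul0r subr_eq0 => /eqP.
Unshelve. all: by end_near. Qed.

(** The sum of the values at [x] and [- x] has derivative zero, and it tends
    to [1]. *)
Lemma cdf_ofN (f : R -> R) (Q : probability R R) (x : R) :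
  mu.-integrable setT (EFin \o f) -> continuous f -> f =1 f \o -%R ->
  (Q : set R -> \bar R) = (fun V => \int[mu]_(t in V) (f t)%:E)%E ->
  cdf_of Q (- x) = 1 - cdf_of Q x.
Proof.
move=> intf cf fN QE.
pose g y := cdf_of Q y + cdf_of Q (- y).
have dg (y : R) : is_derive y 1 g 0.
  rewrite /g QE.
  have d1 := is_derive_cdf_of intf (cf y).
  have d2 := is_derive_cdf_of intf (cf (- y)).
  have -> : 0 = f y + (f (- y) * -1) by rewrite -/((f \o -%R) y) -fN mulrN1 subrr.
  exact: is_deriveD.
have : g x = 1.
  apply: eq_cvg_derive0 => //.
    exact: is_derive_continuous (dg x).
  rewrite -[X in _ --> X]addr0; apply: cvgD; first exact: cvg_cdf_ofy.
  exact: ((cvgNy_compNP _ _).1 (@cvg_cdf_ofNy Q)).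
by rewrite /g => <-; rewrite addrC addKr.
Qed.

End density.

(** * The standard normal distribution function *)

Section normal_cdf.
Context (R : realType).
Implicit Types (x y z u s t : R).

Definition Phi x : R := cdf_of (normal_prob 0 1) x.
Definition phi x : R := normal_pdf 0 1 x.

Lemma phiE x : phi x = normal_peak 1 * expR (- x ^+ 2 / 2).
Proof. by rewrite /phi normal_pdfE ?oner_neq0// /normal_fun subr0 expr1n. Qed.

Lemma phiN x : phi (- x) = phi x.
Proof. by rewrite !phiE sqrrN. Qed.

Lemma is_derive_Phi x : is_derive x 1 Phi (phi x).
Proof.
apply: is_derive_cdf_of; first exact: integrable_normal_pdf.
by apply: continuous_normal_pdf; exact: oner_neq0.
Qed.

(* The law of the identity is [normal_prob 0 1] as a probability on the
   measurable structure that [R] carries by default. *)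
Let id_normal : measurableTypeR R -> R := idfun.

Let measurable_id_normal : measurable_fun setT id_normal.
Proof. exact: measurable_id. Qed.

HB.instance Definition _ :=
  @isMeasurableFun.Build _ _ _ _ id_normal measurable_id_normal.

Let std_normal : probability R R :=
  distribution (normal_prob 0 1) (id_normal : {mfun _ >-> _}).

Lemma PhiN x : Phi (- x) = 1 - Phi x.
Proof.
have sym : normal_pdf 0 1 =1 normal_pdf 0 1 \o (-%R : R -> R).
  by move=> y; rewrite /= -[LHS]phiN.
exact: (@cdf_ofN R (normal_pdf 0 1) std_normal x (integrable_normal_pdf 0 1)
  (continuous_normal_pdf (oner_neq0 R)) sym erefl).
Qed.

Lemma Phi0 : Phi 0 = 2^-1.
Proof. by have := PhiN 0; rewrite oppr0; lra. Qed.

Lemma le_Phi : {homo Phi : x y / x <= y}.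
Proof.
move=> x y xy; apply: fine_le; rewrite ?fin_num_measure//.
by apply: le_measure; rewrite ?inE//; exact: subitvPr.
Qed.

Lemma Phi_ge0 x : 0 <= Phi x.
Proof. by apply: fine_ge0. Qed.

Lemma Phi_le1 x : Phi x <= 1.
Proof. by have := Phi_ge0 (- x); rewrite PhiN subr_ge0. Qed.

Lemma cvg_Phiy : Phi x @[x --> +oo] --> (1 : R).
Proof. exact: (@cvg_cdf_ofy R std_normal). Qed.

Lemma cvg_PhiNy : Phi x @[x --> -oo] --> (0 : R).
Proof. exact: (@cvg_cdf_ofNy R std_normal). Qed.

Lemma is_derive_scale (u y : R) : is_derive y 1 (fun t : R => u * t) u.
Proof.
have := @is_deriveZ R R R id u y 1 1 (is_derive_id y 1).
by rewrite [X in is_derive _ _ _ X](mulr1 u).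
Qed.

(** [Phi] is concave on the nonnegative half-line, so that [Phi - 1 / 2] at
    [u * y] is at least [u] times its value at [y]; that value is at most
    [1 / 2]. *)
Lemma Phi_concave u y : 0 <= u <= 1 -> 0 <= y ->
  Phi y - Phi (u * y) <= (1 - u) / 2.
Proof.
move=> /andP[u0 u1] y0.
pose k t := u * Phi t - Phi (u * t).
have [|c /andP[c0 cy]] := @MVT_is_derive R k (fun t => u * phi t - phi (u * t) * u) _ _ y0.
  move=> t _; apply: is_deriveB.
    exact: (@is_deriveZ R R R Phi u t 1 _ (is_derive_Phi t)).
  exact: (is_derive1_comp (is_derive_Phi _) (is_derive_scale _ _)).
rewrite /k mulr0 subr0 Phi0 => kE.
have : (u * phi c - phi (u * c) * u) * y <= 0.
  rewrite mulr_le0_ge0// mulrC -mulrBl mulr_le0_ge0// subr_le0 !phiE.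
  rewrite ler_pM2l ?normal_peak_gt0 ?oner_neq0// ler_expR.
  rewrite !mulNr lerN2 ler_pM2r ?invr_gt0// ler_sqr ?nnegrE ?mulr_ge0//.
  by rewrite ler_piMl.
rewrite -kE => ku.
have := Phi_le1 y; have := ler_wpM2l (_ : 0 <= 1 - u) (Phi_le1 y).
rewrite subr_ge0 u1 => /(_ isT).
lra.
Qed.

Lemma Phi_dist u x : 0 <= u <= 1 -> `|Phi x - Phi (u * x)| <= (1 - u) / 2.
Proof.
move=> u01; wlog x0 : x / 0 <= x => [wl|].
  have [/wl//|/ltW x0] := leP 0 x.
  have := wl (- x); rewrite oppr_ge0 mulrN !PhiN => /(_ x0).
  by rewrite [X in `|X|](_ : _ = Phi (u * x) - Phi x) 1?distrC//; ring.
rewrite ger0_norm ?Phi_concave// subr_ge0 le_Phi//.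
by case/andP: u01 => u0 u1; rewrite ler_piMl.
Qed.

(** With [u] the ratio of the smaller scale to the larger one, the two terms of
    the minimum are [1 - u ^+ 2] and [u ^- 2 - 1], and both dominate the bound
    [(1 - u) / 2] of [Phi_dist]. *)
Lemma Phi_scale s t z : 0 < s -> 0 < t ->
  `|Phi (z / s) - Phi (z / t)| <=
  Num.min `|1 - t ^+ 2 / s ^+ 2| `|1 - s ^+ 2 / t ^+ 2|.
Proof.
move=> s0 t0; wlog st : s t s0 t0 / s <= t => [wl|].
  by have [/wl->//|/ltW/wl] := leP s t; rewrite distrC minC; apply.
set u := s / t.
have u0 : 0 < u by rewrite divr_gt0.
have u1 : u <= 1 by rewrite ler_pdivrMr// mul1r.
have -> : z / t = u * (z / s) by rewrite /u; field; rewrite !gt_eqF.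
apply: (le_trans (Phi_dist _ _)); first by rewrite ltW.
have -> : s ^+ 2 / t ^+ 2 = u ^+ 2 by rewrite expr_div_n.
have -> : t ^+ 2 / s ^+ 2 = (u ^+ 2)^-1 by rewrite expr_div_n invf_div.
have uu : 0 < u ^+ 2 by rewrite exprn_gt0.
have uu1 : u ^+ 2 <= 1 by rewrite expr_le1// ltW.
rewrite le_min; apply/andP; split; last first.
  by rewrite ger0_norm ?subr_ge0//; nra.
rewrite ler0_norm ?subr_le0 ?invf_ge1// opprB.
apply: (@le_trans _ _ (1 - u ^+ 2)); first by nra.
have := divff (lt0r_neq0 uu); set w := (u ^+ 2)^-1 => uw.
have : 1 <= w by rewrite invf_ge1.
nra.
Qed.

End normal_cdf.

(** * A primitive for the exponential mixture of normal laws *)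

Section mixture.
Context (R : realType).
Variables (r z : R).
Hypotheses (r0 : 0 < r) (r2 : r ^+ 2 = 2) (z0 : 0 < z).
Implicit Types (s t a b : R).

(** The substitution of [t ^+ 2] for the exponential variable avoids square
    roots in the derivatives.  The second summand arises by integrating by
    parts, as a primitive of [expR (- t ^+ 2)] times the derivative of
    [Phi (z / t)]; up to sign, it is [expR (- (r * z)) / 2] times the probability
    that a Brownian motion with drift [r] reaches [z] before the time [t ^+ 2]. *)
Definition mix_prim t : R := - (Phi (z / t) * expR (- t ^+ 2)) -
  2^-1 * (expR (- (r * z)) * (1 - Phi (z / t - r * t)) +
          expR (r * z) * (1 - Phi (z / t + r * t))).

Lemma is_derive_gauss t : is_derive t 1 (fun s => expR (- s ^+ 2) : R)
  (expR (- t ^+ 2) * - (2 * t)).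
Proof.
have d2 : is_derive t 1 (fun s : R => - s ^+ 2) (- (2 * t)).
  apply: is_derive_eq.
  by change (- (t * 1 + t * 1) = - (2 * t)); ring.
exact: (is_derive1_comp (is_derive_expR _) d2).
Qed.

Lemma cvg_gauss_right0 : expR (- t ^+ 2) @[t --> 0^'+] --> (1 : R).
Proof.
have := is_derive_continuous (is_derive_gauss 0).
rewrite /prop_for/continuous_at expr0n/= oppr0 expR0.
exact: cvg_at_right_filter.
Qed.

Lemma is_derive_divl t : t != 0 -> is_derive t 1 (fun s => z / s) (- (z / t ^+ 2)).
Proof.
move=> t0.
have dV := @is_deriveV R id t 1 1 t0 (is_derive_id t (1:R)).
have -> : - (z / t ^+ 2) = z *: (- (t ^- 2) *: 1).
  by rewrite /GRing.scale/= mulr1 mulrN.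
exact: is_deriveZ.
Qed.

(** Completing the square turns both products of an exponential with a shifted
    density into [phi (z / t) * expR (- t ^+ 2)], so that the terms without
    [Phi] cancel. *)
Lemma is_derive_mix_prim t : 0 < t ->
  is_derive t 1 mix_prim (2 * t * expR (- t ^+ 2) * Phi (z / t)).
Proof.
move=> t0; have tN0 : t != 0 by rewrite gt_eqF.
have dz := is_derive_divl tN0.
have dr : is_derive t 1 (fun s => r * s) r by exact: is_derive_scale.
have dP : is_derive t 1 (fun s => Phi (z / s)) (phi (z / t) * - (z / t ^+ 2)).
  exact: (is_derive1_comp (is_derive_Phi _) dz).
have dPB : is_derive t 1 (fun s => Phi (z / s - r * s))
    (phi (z / t - r * t) * (- (z / t ^+ 2) - r)).
  exact: (is_derive1_comp (is_derive_Phi _) (is_deriveB dz dr)).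
have dPD : is_derive t 1 (fun s => Phi (z / s + r * s))
    (phi (z / t + r * t) * (- (z / t ^+ 2) + r)).
  exact: (is_derive1_comp (is_derive_Phi _) (is_deriveD dz dr)).
have dG := is_derive_gauss t.
have EB : expR (- (r * z)) * phi (z / t - r * t) = phi (z / t) * expR (- t ^+ 2).
  rewrite !phiE mulrCA -!mulrA -!expRD; congr (_ * expR _).
  apply/eqP; rewrite -subr_eq0 [X in X == _](_ : _ = (2 - r ^+ 2) * t ^+ 2 / 2).
    by rewrite r2 subrr !mul0r.
  by field; rewrite tN0.
have ED : expR (r * z) * phi (z / t + r * t) = phi (z / t) * expR (- t ^+ 2).
  rewrite !phiE mulrCA -!mulrA -!expRD; congr (_ * expR _).
  apply/eqP; rewrite -subr_eq0 [X in X == _](_ : _ = (2 - r ^+ 2) * t ^+ 2 / 2).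
    by rewrite r2 subrr !mul0r.
  by field; rewrite tN0.
rewrite /mix_prim; apply: is_derive_eq.
rewrite /GRing.scale/=.
rewrite !add0r !mul1r !mulrN !mulrA EB ED.
by field; rewrite ?tN0.
Qed.

(** [Phi (z / t)] is nonincreasing in [t], and [2 * t * expR (- t ^+ 2)] is the
    density of the square root of a standard exponential variable. *)
Lemma mix_prim_bounds a b : 0 < a -> a <= b ->
  Phi (z / b) * (expR (- a ^+ 2) - expR (- b ^+ 2)) <= mix_prim b - mix_prim a
    <= Phi (z / a) * (expR (- a ^+ 2) - expR (- b ^+ 2)).
Proof.
move=> a0 ab.
(* Subtracting the constant [c] under the integral sign. *)
have key c : exists2 t, a <= t <= b & mix_prim b - mix_prim a -
    c * (expR (- a ^+ 2) - expR (- b ^+ 2)) =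
    2 * t * expR (- t ^+ 2) * (Phi (z / t) - c) * (b - a).
  have [|t tab E] := @MVT_is_derive R
      (fun t => mix_prim t + c * expR (- t ^+ 2))
      (fun t => 2 * t * expR (- t ^+ 2) * Phi (z / t) +
                c * (expR (- t ^+ 2) * - (2 * t))) _ _ ab.
    move=> t /andP[at_ _]; apply: is_deriveD.
      exact: is_derive_mix_prim (lt_le_trans a0 at_).
    exact: (@is_deriveZ R R R _ c t 1 _ (is_derive_gauss t)).
  exists t => //; transitivity (mix_prim b + c * expR (- b ^+ 2) -
    (mix_prim a + c * expR (- a ^+ 2))); first by ring.
  by rewrite E; ring.
have pos t : a <= t -> 0 <= 2 * t * expR (- t ^+ 2).
  by move=> at_; rewrite !mulr_ge0 ?expR_ge0// (le_trans (ltW a0)).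
apply/andP; split.
  have [t /andP[at_ tb] E] := key (Phi (z / b)).
  rewrite -subr_ge0 E mulr_ge0 ?subr_ge0// mulr_ge0 ?pos//.
  rewrite subr_ge0 le_Phi// ler_pM2l// lef_pV2// posrE.
    exact: lt_le_trans ab.
  exact: lt_le_trans at_.
have [t /andP[at_ tb] E] := key (Phi (z / a)).
rewrite -subr_le0 E mulr_le0_ge0 ?subr_ge0// mulr_ge0_le0 ?pos//.
rewrite subr_le0 le_Phi// ler_pM2l// lef_pV2// posrE//.
exact: (lt_le_trans a0).
Qed.

Lemma cvg_divl_right0 : z / t @[t --> 0^'+] --> +oo.
Proof.
rewrite (_ : (fun t => z / t) = (fun t => t^-1 * z)); last first.
  by apply/funext => t; rewrite mulrC.
apply: gt0_cvgMly => //.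
apply/gtr0_cvgV0; first by near=> t; rewrite invr_gt0.
rewrite [X in X @ _ --> _](_ : _ = id); last by apply/funext => t; rewrite /= invrK.
exact: cvg_at_right_filter.
Unshelve. all: by end_near. Qed.

Lemma cvg_divl_y : z / t @[t --> +oo] --> (0 : R).
Proof.
rewrite -(mulr0 z); apply: cvgM; first exact: cvg_cst.
apply/(gtr0_cvgV0 (f := id)); last exact: cvg_id.
by near=> t.
Unshelve. all: by end_near. Qed.

Lemma cvg_mix_prim0 : mix_prim t @[t --> 0^'+] --> (-1 : R).
Proof.
have c1 : Phi (z / t) @[t --> 0^'+] --> (1 : R).
  exact: cvg_comp cvg_divl_right0 (@cvg_Phiy R).
have ib : z / t - r * t @[t --> 0^'+] --> +oo.
  apply/cvgryPge => A; near=> t.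
  apply: (@le_trans _ _ (z / t - r)); last first.
    by rewrite lerD2l lerN2 ler_piMr ?ltW//; near: t; exact: nbhs_right_le.
  rewrite lerBrDr; near: t.
  by move/cvgryPge : cvg_divl_right0; apply.
have ib' : z / t + r * t @[t --> 0^'+] --> +oo.
  apply/cvgryPge => A; near=> t.
  apply: (@le_trans _ _ (z / t)); last by rewrite lerDl mulr_ge0 ?ltW.
  near: t; by move/cvgryPge : cvg_divl_right0; apply.
have cB : Phi (z / t - r * t) @[t --> 0^'+] --> (1 : R).
  exact: cvg_comp ib (@cvg_Phiy R).
have cD : Phi (z / t + r * t) @[t --> 0^'+] --> (1 : R).
  exact: cvg_comp ib' (@cvg_Phiy R).
have cG : expR (- t ^+ 2) @[t --> 0^'+] --> (1 : R).
  exact: cvg_gauss_right0.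
rewrite (_ : -1 = - (1 * 1) - 2^-1 * (expR (- (r * z)) * (1 - 1) +
          expR (r * z) * (1 - 1))); last by rewrite subrr; ring.
apply: cvgB; first by apply: cvgN; exact: cvgM.
apply: cvgM; first exact: cvg_cst.
by apply: cvgD; apply: cvgM; rewrite ?{1}/mix_prim//; try exact: cvg_cst;
  apply: cvgB => //; exact: cvg_cst.
Unshelve. all: by end_near. Qed.

Lemma cvg_mix_primy : mix_prim t @[t --> +oo] --> - (2^-1 * expR (- (r * z))).
Proof.
have c1 : Phi (z / t) @[t --> +oo] --> Phi 0.
  apply: (cvg_comp _ _ cvg_divl_y).
  exact: (is_derive_continuous (is_derive_Phi 0)).
have ty : r * t @[t --> +oo] --> +oo.
  apply: gt0_cvgMry => //; exact: cvg_id.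
have ib : z / t - r * t @[t --> +oo] --> -oo.
  apply/cvgrNyPle => A; near=> t.
  have t1 : 1 <= t by near: t; apply: nbhs_pinfty_ge; rewrite num_real.
  apply: (@le_trans _ _ (z - r * t)); last first.
    rewrite lerBlDr -lerBlDl; near: t.
    by move/cvgryPge : ty; apply.
  rewrite lerD2r ler_piMr ?(ltW z0)// invf_le1 ?(lt_le_trans _ t1)//.
have ib' : z / t + r * t @[t --> +oo] --> +oo.
  apply/cvgryPge => A; near=> t.
  apply: (@le_trans _ _ (r * t)); last by rewrite lerDr divr_ge0 ?ltW.
  near: t; by move/cvgryPge : ty; apply.
have cB : Phi (z / t - r * t) @[t --> +oo] --> (0 : R).
  exact: cvg_comp ib (@cvg_PhiNy R).
have cD : Phi (z / t + r * t) @[t --> +oo] --> (1 : R).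
  exact: cvg_comp ib' (@cvg_Phiy R).
have cG : expR (- t ^+ 2) @[t --> +oo] --> (0 : R).
  exact: cvg_gauss_fun.
rewrite [X in _ --> X](_ : _ = - (Phi 0 * 0) - 2^-1 * (expR (- (r * z)) * (1 - 0) +
          expR (r * z) * (1 - 1))); last by rewrite subrr; ring.
apply: cvgB; first by apply: cvgN; exact: cvgM.
apply: cvgM; first exact: cvg_cst.
by apply: cvgD; apply: cvgM; try exact: cvg_cst;
  apply: cvgB => //; exact: cvg_cst.
Unshelve. all: by end_near. Qed.

End mixture.

(** * Geometric mixtures of normal laws and the Laplace law *)

Section geometric_mixture.
Context (R : realType).

(** A standard exponential variable exceeds the square of this number with
    probability [(1 - p) ^+ n]: rounded up to the grid of these squares, it has
    the geometric law. *)
Definition geometric_time (p : R) (n : nat) : R :=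
  Num.sqrt (- ln (1 - p) * n%:R).

Lemma sum_geometric (p : R) M :
  \sum_(i < M) p * (1 - p) ^+ i = 1 - (1 - p) ^+ M.
Proof.
elim: M => [|M IH]; first by rewrite big_ord0 expr0 subrr.
by rewrite big_ord_recr/= IH exprS; ring.
Qed.

Variables (r z p : R).
Hypotheses (r0 : 0 < r) (r2 : r ^+ 2 = 2) (z0 : 0 < z) (p0 : 0 < p) (p1 : p < 1).

(** The case [a = 0] of [mix_prim_bounds], where [mix_prim] has limit [-1] and
    [Phi (z / t)] has limit [1]. *)
Lemma mix_prim_bounds0 b : 0 < b ->
  Phi (z / b) * (1 - expR (- b ^+ 2)) <= mix_prim r z b + 1 <= 1 - expR (- b ^+ 2).
Proof.
move=> b0.
have cG : expR (- t ^+ 2) @[t --> 0^'+] --> (1 : R).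
  exact: cvg_gauss_right0.
have cM := cvg_mix_prim0 r0 z0.
have cE : expR (- t ^+ 2) - expR (- b ^+ 2) @[t --> 0^'+] --> 1 - expR (- b ^+ 2).
  by apply: cvgB => //; exact: cvg_cst.
have cMb : mix_prim r z b - mix_prim r z t @[t --> 0^'+] --> mix_prim r z b + 1.
  rewrite -[X in _ + X]opprK; apply: cvgB => //; exact: cvg_cst.
apply/andP; split.
  rewrite -subr_ge0.
  apply: (cvgr_to_ge (F := 0^'+) (f := fun t => (mix_prim r z b - mix_prim r z t) -
     Phi (z / b) * (expR (- t ^+ 2) - expR (- b ^+ 2)))).
    by apply: cvgB => //; apply: cvgM => //; exact: cvg_cst.
  near=> t; rewrite subr_ge0.
  have t0 : 0 < t by [].
  have tb : t <= b by near: t; exact: nbhs_right_le.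
  by have /andP[] := mix_prim_bounds r2 z0 t0 tb.
rewrite -subr_ge0.
apply: (cvgr_to_ge (F := 0^'+) (f := fun t => (expR (- t ^+ 2) - expR (- b ^+ 2)) -
  (mix_prim r z b - mix_prim r z t))).
  exact: cvgB.
near=> t; rewrite subr_ge0.
have t0 : 0 < t by [].
have tb : t <= b by near: t; exact: nbhs_right_le.
have /andP[_ /le_trans->//] := mix_prim_bounds r2 z0 t0 tb.
rewrite ler_piMl ?Phi_le1// subr_ge0 ler_expR lerN2 ler_sqr ?nnegrE// ltW//.
Unshelve. all: by end_near. Qed.

Local Notation q := (1 - p).
Local Notation lam := (- ln q).
Local Notation tau := (geometric_time p).

Let q0 : 0 < q. Proof. by rewrite subr_gt0. Qed.
Let q1 : q < 1. Proof. by rewrite ltrBlDr ltrDl. Qed.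
Let lam_gt0 : 0 < lam. Proof. by rewrite oppr_gt0 ln_lt0 ?q0. Qed.

Let expR_tau n : expR (- tau n ^+ 2) = q ^+ n.
Proof.
by rewrite sqr_sqrtr ?mulr_ge0// ?ltW// -mulNr expRM_natr opprK lnK.
Qed.

Let tau_gt0 n : 0 < tau n.+1.
Proof. by rewrite sqrtr_gt0 mulr_gt0. Qed.

Let le_tau n : tau n <= tau n.+1.
Proof. by rewrite /geometric_time ler_wsqrtr// ler_pM2l// ler_nat. Qed.

Let qdiff n : q ^+ n - q ^+ n.+1 = p * q ^+ n.
Proof. by rewrite exprS; ring. Qed.

Let w_ge0 n x : 0 <= p * q ^+ n * Phi x.
Proof. by rewrite !mulr_ge0 ?Phi_ge0 ?exprn_ge0// ltW. Qed.

(** The first of two Riemann sum estimates: on each grid interval [Phi (z / t)]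
    is at least its value at the right end point. *)
Lemma mix_prim_tau_ge M :
  \sum_(i < M.+1) p * q ^+ i * Phi (z / tau i.+1) <= mix_prim r z (tau M.+1) + 1.
Proof.
elim: M => [|M IH].
  have := mix_prim_bounds0 (tau_gt0 0); rewrite expR_tau expr1 subKr.
  rewrite big_ord_recr/= big_ord0 add0r expr0 mulr1 [p * Phi _]mulrC.
  by case/andP.
have := mix_prim_bounds r2 z0 (tau_gt0 M) (le_tau M.+1).
rewrite !expR_tau qdiff => /andP[+ _].
by rewrite big_ord_recr/= [Phi _ * _]mulrC; move: IH; lra.
Qed.

(** The value at the left end point bounds the increments from above.  The
    weights decrease in [i], so that each one may be replaced by its
    predecessor; only the first interval, of mass [p], has no predecessor. *)
Lemma mix_prim_tau_le M :
  mix_prim r z (tau M.+1) + 1 <= p + \sum_(i < M) p * q ^+ i * Phi (z / tau i.+1).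
Proof.
elim: M => [|M IH].
  have := mix_prim_bounds0 (tau_gt0 0); rewrite expR_tau expr1 subKr.
  by rewrite big_ord0 addr0 => /andP[].
have := mix_prim_bounds r2 z0 (tau_gt0 M) (le_tau M.+1).
rewrite !expR_tau qdiff => /andP[_ h].
have : Phi (z / tau M.+1) * (p * q ^+ M.+1) <= p * q ^+ M * Phi (z / tau M.+1).
  rewrite mulrC ler_wpM2r ?Phi_ge0// ler_pM2l// exprS ler_piMl ?exprn_ge0// ltW//.
rewrite big_ord_recr/=; move: IH h; lra.
Qed.

(** Passing from the grid points to [sqrt (p * n)] rescales the argument by the
    square root of [p / - ln (1 - p)], which lies between [1 - p] and [1]. *)
Lemma Phi_tau n :
  0 <= Phi (z / Num.sqrt (p * n.+1%:R)) - Phi (z / tau n.+1) <= p / 2.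
Proof.
have lp : p <= lam.
  by rewrite lerNr le_ln1Dx// ltrN2.
(* This is [ln (1 / q) <= 1 / q - 1]. *)
have lq : lam <= p / q.
  rewrite -lnV ?posrE//.
  rewrite [X in ln X](_ : _ = 1 + p / q); last by field; rewrite gt_eqF.
  by apply: le_ln1Dx; rewrite (lt_trans (ltrN10 _))// divr_gt0.
pose u := Num.sqrt (p / lam).
have u0 : 0 <= u by exact: sqrtr_ge0.
have u1 : u <= 1 by rewrite -sqrtr1 ler_wsqrtr// ler_pdivrMr// mul1r.
have uE : u ^+ 2 = p / lam by rewrite sqr_sqrtr// divr_ge0// ltW.
have -> : z / tau n.+1 = u * (z / Num.sqrt (p * n.+1%:R)).
  rewrite /geometric_time /u !sqrtrM ?(ltW p0) ?(ltW lam_gt0)// sqrtrV ?ltW//.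
  by field; rewrite !gt_eqF ?sqrtr_gt0.
set y := z / _.
have y0 : 0 <= y by rewrite divr_ge0 ?sqrtr_ge0// ltW.
apply/andP; split; first by rewrite subr_ge0 le_Phi// ler_piMl.
apply: (le_trans (@Phi_concave R u y _ _)) => //; first exact/andP.
rewrite ler_pM2r ?invr_gt0//.
have : q <= p / lam by rewrite ler_pdivlMr// mulrC -ler_pdivlMr.
rewrite -uE; nra.
Qed.

Lemma sum_Phi_mix_prim M :
  `|\sum_(i < M.+1) p * q ^+ i * Phi (z / Num.sqrt (p * i.+1%:R))
    - (mix_prim r z (tau M.+1) + 1)| <= p.
Proof.
set S := \sum_(i < _) _; pose T := \sum_(i < M.+1) p * q ^+ i * Phi (z / tau i.+1).
have h1 : T <= S.
  apply: ler_sum => i _; rewrite ler_wpM2l ?mulr_ge0 ?exprn_ge0 ?(ltW p0) ?(ltW q0)//.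
  by have /andP[+ _] := Phi_tau i; rewrite subr_ge0.
have h2 : S - T <= p / 2.
  rewrite /S /T -sumrB.
  apply: (@le_trans _ _ (\sum_(i < M.+1) p * q ^+ i * (p / 2))).
    apply: ler_sum => i _; rewrite -mulrBr.
    rewrite ler_wpM2l ?mulr_ge0 ?exprn_ge0 ?(ltW p0) ?(ltW q0)//.
    by have /andP[] := Phi_tau i.
  rewrite -mulr_suml sum_geometric ler_piMl ?divr_ge0 ?(ltW p0)//.
  by rewrite gerBl exprn_ge0// ltW.
have h3 : T <= mix_prim r z (tau M.+1) + 1 by exact: mix_prim_tau_ge.
have h4 : mix_prim r z (tau M.+1) + 1 <= p + T.
  apply: (le_trans (mix_prim_tau_le M)).
  by rewrite lerD2l /T big_ord_recr/= lerDl.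
rewrite ler_norml; move: h1 h2 h3 h4 p0; lra.
Qed.

Lemma cvg_tau : tau n.+1 @[n --> \oo] --> +oo.
Proof.
apply/cvgryPge => A; near=> n.
rewrite (le_trans (ler_norm A))// -sqrtr_sqr ler_wsqrtr// mulrC -ler_pdivrMr//.
apply: (@le_trans _ _ n%:R); last by rewrite ler_nat.
by near: n; exact: nbhs_infty_ger.
Unshelve. all: by end_near. Qed.

(** Here [1 - expR (- (r * z)) / 2] is the limit of [mix_prim + 1] at infinity;
    [laplace_cdf] identifies it as a Laplace distribution function. *)
Lemma geometric_mixture_pos e : 0 < e ->
  \forall M \near \oo, `|\sum_(i < M.+1) p * q ^+ i * Phi (z / Num.sqrt (p * i.+1%:R))
    - (1 - 2^-1 * expR (- (r * z)))| <= p + e.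
Proof.
move=> e0.
have /cvgr_dist_le/(_ _ e0) : mix_prim r z (tau n.+1) @[n --> \oo] -->
    - (2^-1 * expR (- (r * z))).
  exact: cvg_comp cvg_tau (cvg_mix_primy r0 z0).
apply: filterS => M h.
set S := \sum_(i < _) _.
rewrite (_ : S - _ = S - (mix_prim r z (tau M.+1) + 1)
   - (- (2^-1 * expR (- (r * z))) - mix_prim r z (tau M.+1))); last by ring.
apply: (le_trans (ler_normB _ _)); apply: lerD => //.
exact: sum_Phi_mix_prim.
Qed.

End geometric_mixture.

Section laplace_cdf.
Context (R : realType).

Lemma integrable_laplace_pdf (b : R) : 0 < b ->
  (@lebesgue_measure R).-integrable setT (EFin \o laplace_pdf 0 b).
Proof.
move=> b0; apply/integrableP; split.
  apply/measurable_EFinP; apply: continuous_measurable_fun.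
  exact: continuous_laplace_pdf.
under eq_integral do rewrite /= ger0_norm ?laplace_pdf_ge0//.
by rewrite integral_laplace_pdf// ltry.
Qed.

Lemma laplace_cdfN (b x : R) : 0 < b ->
  cdf_of (laplace_prob 0 b) (- x) = 1 - cdf_of (laplace_prob 0 b) x.
Proof.
move=> b0.
have sym : laplace_pdf 0 b =1 laplace_pdf 0 b \o -%R.
  by move=> y; rewrite /laplace_pdf/= !subr0 normrN.
exact: (@cdf_ofN R (laplace_pdf 0 b)
  (Defs_laplace_prob__canonical__probability_measure_Probability 0 b0) x
  (integrable_laplace_pdf b0) (@continuous_laplace_pdf R b 0) sym erefl).
Qed.

Lemma laplace_cdf (b x : R) : 0 < b -> 0 <= x ->
  cdf_of (laplace_prob 0 b) x = 1 - 2^-1 * expR (- (x / b)).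
Proof.
move=> b0 x0.
have dL (y : R) : is_derive y 1 (cdf_of (laplace_prob 0 b)) (laplace_pdf 0 b y).
  apply: is_derive_cdf_of; first exact: integrable_laplace_pdf.
  exact: continuous_laplace_pdf.
have db (y : R) : is_derive y 1 (fun t => - (t / b)) (- b^-1).
  have := is_derive_scale (- b^-1) y.
  by under eq_fun do rewrite mulNr mulrC.
have dE (y : R) : is_derive y 1 (fun t => 2^-1 * expR (- (t / b)))
   (2^-1 * (expR (- (y / b)) * - b^-1)).
  exact: is_deriveZ.
apply/eqP; rewrite eq_sym subr_eq eq_sym; apply/eqP.
apply: (@eq_cvg_derive0 R (fun y => cdf_of (laplace_prob 0 b) y +
    2^-1 * expR (- (y / b))) x).
- move=> y xy; have y0 : 0 < y by exact: le_lt_trans xy.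
  have := is_deriveD (dL y) (dE y).
  rewrite [X in is_derive _ _ _ X -> _](_ : _ = 0)//.
  rewrite /laplace_pdf subr0 gtr0_norm// mulNr invfM; ring.
- exact: is_derive_continuous (is_deriveD (dL x) (dE x)).
- rewrite -[X in _ --> X]addr0; apply: cvgD.
    exact: (@cvg_cdf_ofy R
      (Defs_laplace_prob__canonical__probability_measure_Probability 0 b0)).
  rewrite -[X in _ --> X](mulr0 2^-1); apply: cvgM; first exact: cvg_cst.
  apply: (cvg_comp (fun y => y / b) (fun y => expR (- y))); last exact: cvgr_expR.
  by apply: gt0_cvgMly; rewrite ?invr_gt0//; exact: cvg_id.
Qed.

(** Negative arguments follow from positive ones by the symmetry of both laws,
    at the cost of the missing geometric mass [(1 - p) ^+ M]. *)
Lemma geometric_mixture (p s z : R) : 0 < p -> p < 1 -> 0 < s ->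
  \forall M \near \oo,
  `|\sum_(i < M) p * (1 - p) ^+ i * Phi (z / (s * Num.sqrt (p * i.+1%:R)))
    - cdf_of (laplace_prob 0 (s / Num.sqrt 2)) z| <= 2 * p.
Proof.
move=> p0 p1 s0.
have r0 : 0 < Num.sqrt 2 :> R by rewrite sqrtr_gt0.
have b0 : 0 < s / Num.sqrt 2 by rewrite divr_gt0.
have cq : (1 - p) ^+ M @[M --> \oo] --> 0.
  by apply: cvg_expr; rewrite ger0_norm ?subr_ge0 ?ltW// ltrBlDr ltrDl.
have p20 : 0 < p / 2 by rewrite divr_gt0.
have pos y : 0 < y -> \forall M \near \oo,
  `|\sum_(i < M) p * (1 - p) ^+ i * Phi (y / (s * Num.sqrt (p * i.+1%:R)))
    - cdf_of (laplace_prob 0 (s / Num.sqrt 2)) y| <= p + p / 2.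
  move=> y0; have ys0 : 0 < y / s by rewrite divr_gt0.
  have := @geometric_mixture_pos R (Num.sqrt 2) (y / s) p r0 _ ys0 p0 p1 _ p20.
  rewrite sqr_sqrtr// => /(_ erefl) H.
  apply: near_inftyS; apply: filterS H => M.
  rewrite /= laplace_cdf ?(ltW y0)// invf_div mulrCA.
  by under eq_bigr do rewrite -[y / s / _]mulrA -invfM.
have [z0|z0|<-] := ltgtP 0 z.
- apply: filterS (pos _ z0) => M /le_trans; apply; lra.
- have Nz0 : 0 < - z by rewrite oppr_gt0.
  have h2 : \forall M \near \oo, (1 - p) ^+ M <= p / 2 by exact: cvgr_le cq _ p20.
  apply: filterS2 (pos _ Nz0) h2 => M h1 {}h2.
  have h3 : 0 <= (1 - p) ^+ M by rewrite exprn_ge0// subr_ge0 ltW.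
  move: h1; rewrite laplace_cdfN//.
  under eq_bigr do rewrite mulNr PhiN mulrBr mulr1.
  rewrite sumrB sum_geometric//.
  set S := \sum_(i < _) _; set L := cdf_of _ _.
  by rewrite !ler_norml; lra.
- near=> M.
  have h2 : (1 - p) ^+ M <= p / 2 by near: M; exact: cvgr_le cq _ p20.
  have h3 : 0 <= (1 - p) ^+ M by rewrite exprn_ge0// subr_ge0 ltW.
  rewrite laplace_cdf// mul0r oppr0 expR0 mulr1.
  under eq_bigr do rewrite mul0r Phi0.
  rewrite -mulr_suml sum_geometric// ler_norml; lra.
Unshelve. all: by end_near. Qed.

End laplace_cdf.

(** * Conditioning on the number of summands *)

Lemma measurable_le_set d (T : measurableType d) (R : realType) (f : T -> R) z :
  measurable_fun setT f -> measurable [set w | f w <= z].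
Proof.
move=> mf; have := mf measurableT `]-oo, z]%classic (measurable_itv _).
by rewrite setTI set_itvNyc.
Qed.

Section randomly_stopped.
Context d (T : measurableType d) (R : realType) (P : probability T R).
Variables (X : nat -> {RV P >-> R}) (N : {RV P >-> nat}).

(** The partial sums are measurable for the sigma-algebra generated by the
    family, as required to use the independence of [N]. *)
Lemma sigma_algebra_of_sum n (c : R) (B : set R) : measurable B ->
  sigma_algebra_of X ((fun w => c * \sum_(j < n) X j w) @^-1` B).
Proof.
move=> mB.
pose G := \bigcup_i preimage_set_system setT (X i) measurable.
have mX j : measurable_fun [set: g_sigma_algebraType G] (X j : g_sigma_algebraType G -> R).
  move=> _ A mA; apply: sub_sigma_algebra; exists j => //.
  by exists A.
have mS : measurable_fun [set: g_sigma_algebraType G]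
    ((fun w => c * \sum_(j < n) X j w) : g_sigma_algebraType G -> R).
  by apply: measurable_funM => //; apply: measurable_sum => j; exact: mX.
by have := mS measurableT _ mB; rewrite setTI.
Qed.

Let mNn n : measurable [set w | N w = n].
Proof.
by rewrite -[X in measurable X]setTI; exact: (measurable_funP N) [set n] _.
Qed.

Let mNle M : measurable [set w | (0 < N w <= M)%N].
Proof.
by rewrite -[X in measurable X]setTI; exact: (measurable_funP N) [set n | (0 < n <= M)%N] _.
Qed.

Lemma probability_split (E : set T) M : measurable E ->
  P (E `&` [set w | (0 < N w <= M)%N]) =
  (\sum_(i < M) P (E `&` [set w | N w = i.+1]))%E.
Proof.
move=> mE; elim: M => [|M IH].
  rewrite big_ord0 [X in P X](_ : _ = set0) ?measure0//.
  by apply/seteqP; split => w //= [_]; case: (N w).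
rewrite big_ord_recr/= -IH -measureU.
- congr (P _); apply/seteqP; split => w /=.
    move=> [Ew /andP[N0]]; rewrite leq_eqVlt ltnS => /orP[/eqP ->|NM].
      by right.
    by left; split => //; rewrite N0.
  move=> [[Ew /andP[N0 NM]]|[Ew ->]]; last by split => //; rewrite leqnn.
  by split => //; rewrite N0 ltnW.
- exact: measurableI.
- exact: measurableI.
- apply/seteqP; split => w //= [[_ /andP[_ +]] [_ Nw]].
  by rewrite Nw ltnn.
Qed.

(** Truncation to a finite range of [N] makes this valid whether or not the
    expectation is finite. *)
Lemma expectation_split_ge (f : nat -> R) M : (forall n, 0 <= f n) ->
  (\sum_(i < M) (f i.+1)%:E * P [set w | N w = i.+1] <= 'E_P[fun w => f (N w)])%E.
Proof.
move=> f0.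
have -> : ('E_P[fun w => f (N w)] = \int[P]_w (f (N w))%:E)%E by rewrite unlock.
have mf : measurable_fun setT (fun w => (f (N w))%:E).
  apply/measurable_EFinP.
  exact: (@measurableT_comp _ _ _ _ _ _ f _ N).
have H : (\int[P]_(w in [set w | (0 < N w <= M)%N]) (f (N w))%:E =
    \sum_(i < M) (f i.+1)%:E * P [set w | N w = i.+1])%E.
  elim: M => [|M IH].
    rewrite big_ord0 (_ : [set _ | _] = set0) ?integral_set0//.
    by apply/seteqP; split => w //=; case: (N w).
  rewrite big_ord_recr/= -IH -(integral_cst P (mNn M.+1)).
  rewrite [in RHS](_ : (\int[P]_(x in [set w | N w = M.+1]) cst (f M.+1)%:E x =
      \int[P]_(x in [set w | N w = M.+1]) (f (N x))%:E)%E); last first.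
    by apply: eq_integral => x; rewrite inE/= => ->.
  rewrite -ge0_integral_setU//.
  - congr (integral _ _ _); apply/seteqP; split => w /=.
      move=> /andP[N0]; rewrite leq_eqVlt ltnS => /orP[/eqP ->|NM].
        by right.
      by left; rewrite N0.
    by move=> [/andP[N0 NM]|->]; rewrite ?leqnn// N0 ltnW.
  - exact: measurable_funTS.
  - by move=> w _; rewrite lee_fin.
  - apply/disj_setPLR => w /= /andP[_ +] NM.
    by rewrite NM ltnn.
rewrite -H; apply: ge0_subset_integral => //.
by move=> w _; rewrite lee_fin.
Qed.

Section geometric.
Variable p : R.
Hypothesis hN : forall n, (0 < n)%N ->
     P [set w | N w = n] = (p * (1 - p) ^+ n.-1)%:E.
Hypothesis hNX : independent_of_family N X.

Lemma geometric_le M : P [set w | (0 < N w <= M)%N] = (1 - (1 - p) ^+ M)%:E.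
Proof.
have := @probability_split setT M measurableT; rewrite setTI => ->.
rewrite -sum_geometric// -sumEFin; apply: eq_bigr => i _.
by rewrite setTI hN.
Qed.

(** Up to the event that [N] is not between [1] and [M], whose probability is
    [(1 - p) ^+ M], the law of the random sum is a finite mixture of
    the laws of the partial sums. *)
Lemma cdf_random_sum (c z : R) M :
  `|fine (P [set w | c * random_sum X N w <= z]) -
    \sum_(i < M) p * (1 - p) ^+ i *
      fine (P [set w | c * (\sum_(j < i.+1) X j w) <= z])| <= (1 - p) ^+ M.
Proof.
set E := [set w | _].
have mE : measurable E.
  apply: (@measurable_le_set _ _ _ (fun w => c * random_sum X N w)).
  by apply: measurable_funM => //; exact: measurable_random_sum.
have key : P (E `&` [set w | (0 < N w <= M)%N]) =
  (\sum_(i < M) p * (1 - p) ^+ i *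
      fine (P [set w | c * (\sum_(j < i.+1) X j w) <= z]))%:E.
  rewrite probability_split// -sumEFin; apply: eq_bigr => i _.
  set A := [set w | c * (\sum_(j < i.+1) X j w) <= z].
  have sA : sigma_algebra_of X A.
    have := @sigma_algebra_of_sum i.+1 c _ (measurable_itv `]-oo, z]).
    by rewrite set_itvNyc.
  have mA : measurable A.
    apply: (@measurable_le_set _ _ _ (fun w => c * \sum_(j < i.+1) X j w)).
    by apply: measurable_funM => //; apply: measurable_sum => j; exact: measurable_funP.
  rewrite EFinM fineK ?fin_num_measure// -[X in X%:E]/(p * (1 - p) ^+ i.+1.-1) -hN//.
  have := @hNX [set i.+1] A I sA.
  rewrite (_ : N @^-1` [set i.+1] = [set w | N w = i.+1])// => <-.
  congr (P _); apply/seteqP; split => w /=.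
    by move=> [+ Nw]; rewrite /E/= /random_sum Nw.
  by move=> [Nw Aw]; split => //; rewrite /E/= /random_sum Nw.
have mE' : measurable (E `&` [set w | (0 < N w <= M)%N]) by exact: measurableI.
have mE'' : measurable (E `\` [set w | (0 < N w <= M)%N]) by exact: measurableD.
have PE : P E = (P (E `&` [set w | (0 < N w <= M)%N]) +
                P (E `\` [set w | (0 < N w <= M)%N]))%E.
  by rewrite addeC; exact: measureDI.
rewrite PE key fineD ?fin_num_measure//= addrC addKr ger0_norm ?fine_ge0//.
rewrite -lee_fin fineK ?fin_num_measure//.
apply: (@le_trans _ _ (P (~` [set w | (0 < N w <= M)%N]))).
  by apply: le_measure => [||w []//]; rewrite inE//; exact: measurableC.
by rewrite probability_setC// geometric_le -EFinB subKr.
Qed.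

End geometric.
End randomly_stopped.

(** * Kolmogorov distance and moments *)

Section kolmogorov.
Context (R : realType).

Lemma kolmogorov_dist_ge (m1 m2 : set R -> \bar R) z :
  (`| m1 `]-oo, z]%classic - m2 `]-oo, z]%classic | <= kolmogorov_dist m1 m2)%E.
Proof. by apply: ereal_sup_ubound; exists z. Qed.

Lemma kolmogorov_dist_le (m1 m2 : set R -> \bar R) (x : \bar R) :
  (forall z, `| m1 `]-oo, z]%classic - m2 `]-oo, z]%classic | <= x)%E ->
  (kolmogorov_dist m1 m2 <= x)%E.
Proof. by move=> h; apply: ge_ereal_sup => _ [z _ <-]. Qed.

End kolmogorov.

Section moments.
Context d (T : measurableType d) (R : realType) (P : probability T R).
Variable Y : {RV P >-> R}.
Hypothesis Y2 : (0 < 'E_P[fun w => (Y w ^+ 2)%R])%E.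
Hypothesis Y3 : ('E_P[fun w => (`|Y w| ^+ 3)%R] < +oo)%E.

Let expectationE (f : T -> R) : ('E_P[f] = \int[P]_w (f w)%:E)%E.
Proof. by rewrite unlock. Qed.

Let mY : measurable_fun setT (fun w => Y w).
Proof. exact: measurable_funP. Qed.

Let mY2 : measurable_fun setT (fun w => Y w ^+ 2).
Proof. exact: measurable_funX. Qed.

Let mY3 : measurable_fun setT (fun w => `|Y w| ^+ 3).
Proof. by apply: measurable_funX; exact: measurableT_comp. Qed.

(** Squares are at most one plus cubes. *)
Lemma second_moment_fin_num : 'E_P[fun w => (Y w ^+ 2)%R]%E \is a fin_num.
Proof.
rewrite ge0_fin_numE; last by apply: expectation_ge0 => w; exact: sqr_ge0.
apply: (@le_lt_trans _ _ ('E_P[fun w => (1 + `|Y w| ^+ 3)%R])%E).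
  apply: expectation_le => //.
  - by apply: measurable_funD.
  - by move=> w; exact: sqr_ge0.
  - apply: aeW => w; rewrite -real_normK ?num_real//.
    set t := `|Y w|; have t0 : 0 <= t by exact: normr_ge0.
    have [t1|/ltW t1] := leP t 1.
      by rewrite (le_trans (exprn_ile1 _ t0 t1))// lerDl exprn_ge0.
    by rewrite [_ ^+ 3]exprS ler_wpDl// ler_peMl// exprn_ge0.
have -> : ('E_P[fun w => (1 + `|Y w| ^+ 3)%R] = 1 + 'E_P[fun w => (`|Y w| ^+ 3)%R])%E.
  rewrite !expectationE.
  under eq_integral do rewrite EFinD.
  rewrite ge0_integralD//.
    congr (_ + _)%E; rewrite integral_cst//.
    by rewrite mul1e; exact: (probability_setT P).
  exact/measurable_EFinP.
by rewrite lte_add_pinfty// ltry.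
Qed.

Lemma second_moment_gt0 : 0 < second_moment Y.
Proof. by rewrite -lte_fin fineK ?second_moment_fin_num. Qed.

Lemma abs_third_moment_ge0 : 0 <= abs_third_moment Y.
Proof. by apply: fine_ge0; apply: expectation_ge0 => w; rewrite exprn_ge0. Qed.

(** Otherwise the variable vanishes almost everywhere, which contradicts the
    positivity of its second moment. *)
Lemma abs_third_moment_gt0 : 0 < abs_third_moment Y.
Proof.
rewrite lt_neqAle abs_third_moment_ge0 andbT; apply/eqP => E0.
have E30 : ('E_P[fun w => (`|Y w| ^+ 3)%R] = 0)%E.
  rewrite -[LHS]fineK ?ge0_fin_numE//.
    by rewrite -/(abs_third_moment Y) -E0.
  by apply: expectation_ge0 => w; rewrite exprn_ge0.
have : ae_eq P setT (fun w => (`|Y w| ^+ 3)%:E) (cst 0%E).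
  apply/ae_eq_integral_abs => //; first exact/measurable_EFinP.
  rewrite -E30 expectationE; apply: eq_integral => w _.
  by rewrite gee0_abs// lee_fin exprn_ge0.
move=> Y0; have : ('E_P[fun w => (Y w ^+ 2)%R] = 0)%E.
  rewrite expectationE -(@integral0 _ _ _ P setT).
  apply: ae_eq_integral => //; first exact/measurable_EFinP.
  apply: filterS Y0 => w /(_ I) [/eqP]; rewrite expf_eq0/= normr_eq0 => /eqP Yw _.
  by rewrite Yw expr0n.
by move=> h; move: Y2; rewrite h ltxx.
Qed.

End moments.

(** * Normal approximation of the partial sums *)

Section berry_esseen.
Context (R : realType) (CK : R) (hCK : berry_esseen_constant CK).
Context d (T : measurableType d) (P : probability T R) (X : nat -> {RV P >-> R}).
Hypothesis hXind : mutually_independent X.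
Hypothesis hX1 : forall j, ('E_P[X j] = 0)%E.
Hypothesis hX2 : forall j, (0 < 'E_P[fun w => (X j w ^+ 2)%R])%E.
Hypothesis hX3 : forall j, ('E_P[fun w => (`|X j w| ^+ 3)%R] < +oo)%E.

(** A family of sets indexed by ['I_n] is extended to all indices by the full
    set. *)
Lemma mutually_independent_ord n : mutually_independent (fun j : 'I_n => X j).
Proof.
move=> s A us mA.
pose A' k := if insub k is Some j then A j else setT.
have A'E (j : 'I_n) : A' j = A j by rewrite /A' valK.
have /(_ _) := hXind (s := map val s) (A := A').
rewrite map_inj_uniq; last exact: val_inj.
move=> /(_ us); rewrite big_map => H.
under eq_bigr do rewrite -A'E.
rewrite -H.
  congr (P _); apply/seteqP; split => w /= Hw k /=.
    by move=> /mapP[j js ->]; rewrite A'E; exact: Hw.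
  by move=> ks; rewrite -A'E; apply: Hw => /=; exact: map_f.
by move=> k; rewrite /A'; case: insub.
Qed.

(** The bound for a single summand is nonnegative and its third moment is
    positive.  The sign of the constant matters where it multiplies an
    expectation that may be infinite. *)
Lemma berry_esseen_constant_ge0 : 0 <= CK.
Proof.
have := @hCK d T P 1 (fun j : 'I_1 => X j) (ltn0Sn 0)
  (@mutually_independent_ord 1) (fun j => hX1 j) (fun j => hX2 j) (fun j => hX3 j).
move=> /= H.
have := le_trans (le_trans (abse_ge0 _) (kolmogorov_dist_ge _ _ 0)) H.
rewrite lee_fin pmulr_lge0// !big_ord1 mulr_gt0 ?abs_third_moment_gt0//.
by rewrite invr_gt0 exprn_gt0// sqrtr_gt0 second_moment_gt0.
Qed.

Lemma mean_second_moment_gt0 n : 0 < mean_second_moment X n.+1.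
Proof.
rewrite mulr_gt0 ?invr_gt0// big_ord_recl ltr_pwDl ?second_moment_gt0//.
by apply: sumr_ge0 => i _; rewrite ltW ?second_moment_gt0.
Qed.

(** The Berry-Esseen bound for the first [n + 1] variables, in terms of the mean
    moments: the standard deviation of their sum is the square root of [n + 1]
    times that of the mean second moment. *)
Lemma berry_esseen_mean n c z : 0 < c ->
  `|fine (P [set w | c * (\sum_(j < n.+1) X j w) <= z])
    - Phi (z / (Num.sqrt (mean_second_moment X n.+1) * (c * Num.sqrt n.+1%:R)))|
  <= CK * ((Num.sqrt n.+1%:R)^-1 * (mean_abs_third_moment X n.+1 /
         Num.sqrt (mean_second_moment X n.+1) ^+ 3)).
Proof.
move=> c0.
have n0 : 0 < n.+1%:R :> R by [].
set m := mean_second_moment X n.+1; have m0 : 0 < m by exact: mean_second_moment_gt0.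
pose B := Num.sqrt (\sum_(j < n.+1) second_moment (X j)).
have BE : B = Num.sqrt n.+1%:R * Num.sqrt m.
  rewrite -sqrtrM// /m /mean_second_moment mulrA divff ?mul1r// gt_eqF//.
have B0 : 0 < B by rewrite BE mulr_gt0 ?sqrtr_gt0.
pose z' := z / (c * B).
have := @hCK d T P n.+1 (fun j : 'I_n.+1 => X j) (ltn0Sn n)
  (@mutually_independent_ord n.+1) (fun j => hX1 j) (fun j => hX2 j) (fun j => hX3 j).
rewrite /= -/B => H.
have {H} := le_trans (kolmogorov_dist_ge _ _ z') H.
set S := (B^-1 *: _ : {mfun T >-> R}).
have SE w : S w = B^-1 * (\sum_(j < n.+1) X j w).
  rewrite -[LHS]/(B^-1 * (\sum_(j < n.+1) (X j : {mfun T >-> R}) : {mfun T >-> R}) w).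
  by rewrite mfun_sum.
have -> : distribution P S `]-oo, z']%classic = P [set w | c * (\sum_(j < n.+1) X j w) <= z].
  rewrite /distribution /pushforward; congr (P _).
  apply/funext => w /=; rewrite in_itv/=; congr is_true.
  rewrite -[X in (X <= _) = _]/(S w) SE.
  by rewrite mulrC ler_pdivrMr// /z' invfM mulrA mulfVK ?gt_eqF// ler_pdivlMr// mulrC.
have mA : measurable [set w | c * (\sum_(j < n.+1) X j w) <= z].
  apply: (@measurable_le_set _ _ _ (fun w => c * \sum_(j < n.+1) X j w)).
  by apply: measurable_funM => //; apply: measurable_sum => j; exact: measurable_funP.
have -> : normal_prob 0 1 `]-oo, z']%classic = (Phi z')%:E.
  by rewrite /Phi /cdf_of fineK// fin_num_measure.
rewrite -[P _]fineK ?fin_num_measure// -EFinB abse_EFin lee_fin.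
have -> : z' = z / (Num.sqrt m * (c * Num.sqrt n.+1%:R)).
  by rewrite /z' BE; congr (_ / _); ring.
move=> /le_trans; apply.
rewrite le_eqVlt; apply/orP; left; apply/eqP; congr (_ * _).
have -> : \sum_(j < n.+1) abs_third_moment (X j) = n.+1%:R * mean_abs_third_moment X n.+1.
  by rewrite /mean_abs_third_moment mulrA divff ?mul1r// gt_eqF.
have sn0 : Num.sqrt n.+1%:R != 0 :> R by rewrite gt_eqF// sqrtr_gt0.
have sm0 : Num.sqrt m != 0 :> R by rewrite gt_eqF// sqrtr_gt0.
rewrite BE -[X in _ * (X * _)](sqr_sqrtr (ltW n0)).
by field; rewrite sn0 sm0.
Qed.

End berry_esseen.

(** * The Laplace approximation *)

Theorem theorem3p5 (R : realType) (CK : R)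
  (hCK : berry_esseen_constant CK)
  (d : measure_display) (T : measurableType d) (P : probability T R)
  (X : nat -> {RV P >-> R}) (N : {RV P >-> nat}) (p sigmahat : R)
  (hXind : mutually_independent X)
  (hX1 : forall j, ('E_P[X j] = 0)%E)
  (hX2 : forall j, (0 < 'E_P[fun w => (X j w ^+ 2)%R])%E)
  (hX3 : forall j, ('E_P[fun w => (`|X j w| ^+ 3)%R] < +oo)%E)
  (hp0 : 0 < p) (hp1 : p < 1)
  (hNX : independent_of_family N X)
  (hN : forall n, (0 < n)%N ->
     P [set w | N w = n] = (p * (1 - p) ^+ n.-1)%:E)
  (hsigma : 0 < sigmahat)
  (hlim : mean_second_moment X n @[n --> \oo] --> sigmahat ^+ 2) :
  let W : {mfun T >-> R} :=
    Num.sqrt p *: (random_sum X N : {mfun T >-> R}) in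
  (kolmogorov_dist (distribution P W)
     (laplace_prob 0 (sigmahat / Num.sqrt 2)) <=
   (12 * p)%:E
   + p%:E * \sum_(1 <= n <oo)
       ((1 - p) ^+ n.-1 *
        Num.min `|1 - sigmahat ^+ 2 / mean_second_moment X n|
                `|1 - mean_second_moment X n / sigmahat ^+ 2|)%:E
   + CK%:E * 'E_P[fun w =>
       ((Num.sqrt (N w)%:R)^-1 *
        (mean_abs_third_moment X (N w) /
         Num.sqrt (mean_second_moment X (N w)) ^+ 3))%R])%E.
Proof.
cbv zeta; set W := (X in distribution P X); set rhs := (X in (_ <= X)%E).
pose m := mean_second_moment X.
pose f n := (Num.sqrt n%:R)^-1 *
  (mean_abs_third_moment X n / Num.sqrt (mean_second_moment X n) ^+ 3).
pose g n := Num.min `|1 - sigmahat ^+ 2 / m n| `|1 - m n / sigmahat ^+ 2|.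
have q0 : 0 <= 1 - p by rewrite subr_ge0 ltW.
have CK0 : 0 <= CK by exact: (berry_esseen_constant_ge0 hCK hXind hX1 hX2 hX3).
have f0 n : 0 <= f n.
  rewrite mulr_ge0 ?invr_ge0// mulr_ge0 ?invr_ge0 ?exprn_ge0//.
  rewrite mulr_ge0 ?invr_ge0//; apply: sumr_ge0 => j _.
  exact: abs_third_moment_ge0.
have g0 n : 0 <= g n by rewrite le_min !normr_ge0.
have b0 : 0 < sigmahat / Num.sqrt 2 by rewrite divr_gt0 ?sqrtr_gt0.
have rhs_ge M : ((12 * p + p * (\sum_(i < M) (1 - p) ^+ i * g i.+1) +
    CK * (\sum_(i < M) p * (1 - p) ^+ i * f i.+1))%:E <= rhs)%E.
  rewrite !EFinD; apply: leeD; first apply: leeD => //.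
    rewrite EFinM; apply: lee_wpmul2l; first by rewrite lee_fin ltW.
    apply: (@le_trans _ _ (\sum_(1 <= n < M.+1) ((1 - p) ^+ n.-1 * g n)%:E)%E).
      rewrite big_add1/= big_mkord sumEFin//.
    apply: nneseries_lim_ge => n _ _.
    by rewrite lee_fin mulr_ge0 ?exprn_ge0.
  rewrite EFinM; apply: lee_wpmul2l; first by rewrite lee_fin.
  apply: le_trans (expectation_split_ge N M f0).
  rewrite -sumEFin; apply: lee_sum => i _.
  by rewrite hN// -EFinM mulrC.
apply: kolmogorov_dist_le => z.
pose Q := Defs_laplace_prob__canonical__probability_measure_Probability 0 b0.
have -> : laplace_prob 0 (sigmahat / Num.sqrt 2) `]-oo, z]%classic =
    (cdf_of (laplace_prob 0 (sigmahat / Num.sqrt 2)) z)%:E.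
  by rewrite /cdf_of fineK// -[laplace_prob _ _]/(Q : set R -> \bar R) fin_num_measure.
have -> : distribution P W `]-oo, z]%classic =
    (fine (P [set w | Num.sqrt p * random_sum X N w <= z]))%:E.
  have -> : distribution P W `]-oo, z]%classic =
      P [set w | Num.sqrt p * random_sum X N w <= z].
    by rewrite /distribution /pushforward; congr (P _).
  rewrite fineK// fin_num_measure//.
  apply: (@measurable_le_set _ _ _ (fun w => Num.sqrt p * random_sum X N w)).
  by apply: measurable_funM => //; exact: measurable_random_sum.
have cq : (1 - p) ^+ M @[M --> \oo] --> 0.
  by apply: cvg_expr; rewrite ger0_norm// ltrBlDr ltrDl.
near \oo => M.
have h1 : (1 - p) ^+ M <= p by near: M; exact: cvgr_le cq _ hp0.
have h2 : `|\sum_(i < M) p * (1 - p) ^+ i * Phi (z / (sigmahat * Num.sqrt (p * i.+1%:R)))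
    - cdf_of (laplace_prob 0 (sigmahat / Num.sqrt 2)) z| <= 2 * p.
  by near: M; exact: geometric_mixture.
have h3 := cdf_random_sum hN hNX (Num.sqrt p) z M.
rewrite -EFinB abse_EFin; apply: le_trans (rhs_ge M); rewrite lee_fin.
set pW := fine _ in h3 *; set L := cdf_of _ _ in h2 *.
set A := \sum_(i < M) _ in h3; set C := \sum_(i < M) _ in h2.
have h4 : `|A - C| <= p * (\sum_(i < M) (1 - p) ^+ i * g i.+1) +
    CK * (\sum_(i < M) p * (1 - p) ^+ i * f i.+1).
  rewrite -sumrB !mulr_sumr -big_split/=; apply: (le_trans (ler_norm_sum _ _ _)).
  apply: ler_sum => i _.
  rewrite -mulrBr normrM ger0_norm ?mulr_ge0 ?exprn_ge0 ?(ltW hp0)//.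
  rewrite [X in _ <= X](_ : _ = p * (1 - p) ^+ i * (g i.+1 + CK * f i.+1)); last by ring.
  rewrite ler_wpM2l ?mulr_ge0 ?exprn_ge0 ?(ltW hp0)//.
  have sp0 : 0 < Num.sqrt p by rewrite sqrtr_gt0.
  have BE := berry_esseen_mean hCK hXind hX1 hX2 hX3 i z sp0.
  have m0 : 0 < m i.+1 by exact: mean_second_moment_gt0 hX2 hX3 i.
  have := @Phi_scale R (Num.sqrt (m i.+1)) sigmahat (z / Num.sqrt (p * i.+1%:R)).
  rewrite sqrtr_gt0 => /(_ m0 hsigma).
  rewrite sqr_sqrtr ?(ltW m0)// -/(g i.+1).
  rewrite -!mulrA -!invfM (mulrC _ sigmahat) (mulrC _ (Num.sqrt (m _))).
  rewrite -sqrtrM ?(ltW hp0)// in BE.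
  move: BE; rewrite -/(f i.+1) -/(m _).
  set a := fine _; set b := Phi _; set c := Phi _ => h5 h6.
  (* [b] is the normal law with the variance of the partial sum itself. *)
  rewrite (_ : a - c = (b - c) + (a - b)); last by ring.
  by rewrite (le_trans (ler_normD _ _))// lerD.
(* The errors of truncation, of the conditional laws, and of the mixture. *)
rewrite (_ : pW - L = (pW - A) + (A - C) + (C - L)); last by ring.
have := ler_normD (pW - A + (A - C)) (C - L); have := ler_normD (pW - A) (A - C).
move: h1 h2 h3 h4 (hp0); lra.
Unshelve. all: by end_near. Qed.
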